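(* Let $n\ge d\ge 1$ be integers. For any monic degree-$d$ polynomial $p(x)$, the polynomial $p(x,t)=\big(p\boxplus_d^n G_{n,d}^{[t]}\big)(x)$, $t\ge 0$, satisfies the partial differential equation $$\partial_t p(x,t)=-2\left(x\,\partial_x^2+(n+1)\,\partial_x\right)p(x,t)$$ with initial condition $p(x,0)=p(x)$.
   Context: Rectangular convolution: for monic degree-$d$ polynomials $p(x)=x^d+\sum_{i=1}^d a_{2i}x^{d-i}$ and $q(x)=x^d+\sum_{i=1}^d b_{2i}x^{d-i}$, with $a_0=b_0=1$, the $(n,d)$-rectangular finite free convolution is $$(p\boxplus_d^n q)(x)=x^d+\sum_{k=1}^d x^{d-k}\sum_{\substack{i,j\ge 0\\ i+j=k}}\frac{(d-i)!(d-j)!}{d!(d-k)!}\,\frac{(n+d-i)!(n+d-j)!}{(n+d)!(n+d-k)!}\,a_{2i}b_{2j}.$$ Laguerre heat polynomials: with $m^{\downarrow k}=m(m-1)\cdots(m-k+1)$ for $k\ge 1$ and $m^{\downarrow 0}=1$, let $L_d^{(\alpha)}(x)=\sum_{k=0}^d\frac{(d+\alpha)^{\downarrow k}}{(d-k)!\,k!}(-x)^{d-k}$. For $t>0$ set $G_{n,d}^{[t]}(x)=(-2t)^d\, d!\, L_d^{(n)}\!\left(\frac{x}{2t}\right)$, and $G_{n,d}^{[0]}(x)=x^d$ (the value at $t=0$ of the resulting polynomial expression in $x$ and $t$). *)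

(* Defs.v *)
From mathcomp Require Import all_boot all_order all_algebra.
From mathcomp Require Import boolp classical_sets topology normedtype derive.

Set Implicit Arguments.
Unset Strict Implicit.
Unset Printing Implicit Defensive.

Import Order.TTheory GRing.Theory Num.Theory.
Import numFieldNormedType.Exports.

Local Open Scope ring_scope.
Local Open Scope classical_set_scope.

(* m (m - 1) ... (m - k + 1); the library's m ^_ k only takes m : nat. *)
Definition falling {K : numFieldType} (m : K) (k : nat) : K :=
  \prod_(i < k) (m - i%:R).

Definition laguerre {K : numFieldType} (d : nat) (alpha : K) : {poly K} :=
  \sum_(k < d.+1)
     (falling (d%:R + alpha) k / ((d - k)`!%:R * k`!%:R)) *: (- 'X) ^+ (d - k).

(* Only the values at t >= 0 are meaningful. *)
Definition laguerre_heat {K : numFieldType} (n d : nat) (t : K) : {poly K} :=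
  if t == 0 then 'X^d
  else ((- 2 * t) ^+ d * d`!%:R)
         *: (laguerre d n%:R \Po ((2 * t)^-1 *: 'X)).

(* Meaningful for p and q monic of degree d: the coefficient a_{2i} of X^{d-i}
   in p is p`_(d - i), and likewise b_{2j} = q`_(d - j). *)
Definition rect_conv {K : numFieldType} (n d : nat) (p q : {poly K}) :
    {poly K} :=
  'X^d + \sum_(1 <= k < d.+1)
    (\sum_(i < k.+1) let j := (k - i)%N in
       ((d - i)`!%:R * (d - j)`!%:R) / (d`!%:R * (d - k)`!%:R)
       * (((n + d - i)`!%:R * (n + d - j)`!%:R)
          / ((n + d)`!%:R * (n + d - k)`!%:R))
       * p`_(d - i) * q`_(d - j)) *: 'X^(d - k).

(* f, regarded as a function on D only, has derivative l at a: the difference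
   quotient of derivable/is_derive, with a + h restricted to D.  When D is
   [set s | 0 <= s], this is one-sided at a = 0; and if K is a field of complex
   numbers, whose nonnegative elements are the nonnegative reals, it is the
   derivative with respect to a real variable. *)
Definition is_derive_within {K : numFieldType} (D : set K) (f : K -> K)
    (a l : K) : Prop :=
  h^-1 * (f (a + h) - f a) @[h --> within [set h | D (a + h)] (0 : K)^'] --> l.

(* At interior points of D this is the derivative of the library. *)
Lemma is_derive_within_nbhs (K : numFieldType) (D : set K) (f : K^o -> K^o)
    (a l : K^o) :
  nbhs a D -> is_derive_within D f a l <-> is_derive a 1 f l.
Proof.
move=> aD.
pose g (h : K) : K := h^-1 * (f (a + h) - f a).
have gE : (fun h : K => h^-1 *: ((f \o shift a) (h *: (1 : K^o)) - f a)) = g.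
  apply/funext => h; rewrite /g /= /GRing.scale /= mulr1.
  by congr (_ * (f _ - _)); exact: addrC.
have wE : within [set h | D (a + h)] (0 : K)^' = (0 : K)^'.
  have nD : (0 : K)^' [set h | D (a + h)].
    have D0 : nbhs (0 : K) [set h | D (a + h)].
      exact: (iffLR (@nbhs0P K K^o D a) aD).
    by apply: filterS D0 => h /= Dh _.
  apply/seteqP; split => A AD; last by apply: filterS AD => h /= Ah.
  by apply: filterS2 nD AD => h /= Dh; apply.
rewrite /is_derive_within wE -/g; split=> [gl|[dg <-]].
  apply: DeriveDef; first by rewrite /derivable gE; apply/cvg_ex; exists l.
  by rewrite /derive gE; exact: (cvg_lim (@norm_hausdorff _ _) gl).
by move: dg; rewrite /derivable /derive gE.
Qed.

(* Main.v *)
Require Import Defs.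
From mathcomp Require Import all_boot all_order all_algebra.
From mathcomp Require Import boolp classical_sets topology normedtype derive.
From mathcomp Require Import functions ring.

Import Order.TTheory GRing.Theory Num.Theory.
Import numFieldNormedType.Exports.

Local Open Scope ring_scope.
Local Open Scope classical_set_scope.

(** The idea is that rectangular convolution with the Laguerre heat polynomial
    is the heat flow exp(s B), s = - 2 t, of the Bessel-type operator
    B = X D^2 + (n + 1) D, where D = d/dX.  The equation is then just
    d/dt exp(- 2 t B) p = - 2 B exp(- 2 t B) p, and B is nilpotent on
    polynomials of bounded degree, so the exponential is a finite sum.

    The identification rests on the weights w m = m! (n + m)!.  Since
    B X^m = m (n + m) X^(m - 1) = (w m / w (m - 1)) X^(m - 1), the weighted
    coefficients w m * p_m simplify everything: B shifts them down by one place
    (coef_iter_bessel_op), so exp(s B) convolves them with the sequence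
    s^j / j!.  The coefficients in the definition of the rectangular
    convolution are w (d - i) w (d - j) / (w d w (d - k)), so it too is,
    up to the factor 1 / w d, a plain convolution of weighted coefficients
    (rect_convE), and the weighted coefficients of the Laguerre heat polynomial
    are exactly
    w d * (- 2 t)^j / j! (coef_laguerre_heat).  Hence rect_conv_laguerre_heat;
    the derivative in t is that of a polynomial in t (deriv_expsum). *)

(** * The Bessel-type operator and its heat flow *)

Definition bessel_op {K : numFieldType} (n : nat) (p : {poly K}) : {poly K} :=
  'X * p^`(2) + (n%:R + 1) *: p^`().

Definition weight (K : numFieldType) (n m : nat) : K :=
  m`!%:R * (n + m)`!%:R.

(** The exponential series exp(s B) p, truncated after N terms; it is the whole
    exponential as soon as size p <= N. *)
Definition heat_flow {K : numFieldType} (n N : nat) (s : K) (p : {poly K}) :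
    {poly K} :=
  \sum_(j < N) (s ^+ j / j`!%:R) *: iter j (bessel_op n) p.

Lemma natf_fact_neq0 (K : numFieldType) (m : nat) : m`!%:R != 0 :> K.
Proof. by rewrite pnatr_eq0 -lt0n fact_gt0. Qed.

Lemma weight_neq0 (K : numFieldType) (n m : nat) : weight K n m != 0.
Proof. by rewrite mulf_neq0 ?natf_fact_neq0. Qed.

Lemma weightS (K : numFieldType) (n m : nat) :
  weight K n m.+1 = m.+1%:R * (n + m.+1)%:R * weight K n m.
Proof. by rewrite /weight addnS !factS !natrM; ring. Qed.

Lemma coef_bessel_op (K : numFieldType) (n m : nat) (p : {poly K}) :
  (bessel_op n p)`_m = m.+1%:R * (n + m.+1)%:R * p`_m.+1.
Proof.
rewrite coefD coefXM coefZ coef_deriv coef_derivn.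
case: m => [|m] /=; first by rewrite natrD -mulr_natr; ring.
rewrite add2n !ffactnS ffactn0 muln1 /= -[in RHS]natr1 natrD.
by rewrite -!(mulr_natr p`_m.+2) natrM -(natr1 m.+1); ring.
Qed.

Lemma bessel_op_lincomb (K : numFieldType) (n N : nat) (c : nat -> K)
    (q : nat -> {poly K}) :
  bessel_op n (\sum_(j < N) c j *: q j) = \sum_(j < N) c j *: bessel_op n (q j).
Proof.
apply/polyP => m; rewrite coef_bessel_op !coef_sum mulr_sumr.
by apply: eq_bigr => j _; rewrite !coefZ coef_bessel_op mulrCA.
Qed.

(** In the weighted coefficients the operator is a shift, because
    weight m.+1 / weight m is the factor by which it multiplies X^(m+1). *)
Lemma coef_iter_bessel_op (K : numFieldType) (n j m : nat) (p : {poly K}) :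
  (iter j (bessel_op n) p)`_m =
  weight K n (m + j) / weight K n m * p`_(m + j).
Proof.
elim: j m => [|j IHj] m; first by rewrite addn0 divff ?weight_neq0 ?mul1r.
rewrite iterS coef_bessel_op IHj addSnnS weightS; set u := _ * _%:R.
have u0 : u != 0 by rewrite mulf_neq0 ?pnatr_eq0 // addnS.
by rewrite -addSnnS; field; rewrite u0 weight_neq0.
Qed.

Lemma iter_bessel_op_eq0 (K : numFieldType) (n N : nat) (p : {poly K}) :
  (size p <= N)%N -> iter N (bessel_op n) p = 0.
Proof.
move=> pN; apply/polyP => m; rewrite coef0 coef_iter_bessel_op.
by rewrite nth_default ?mulr0 // (leq_trans pN) // leq_addl.
Qed.

(** * Convolution with a Laguerre heat polynomial is the heat flow *)

(** The separate leading term of the definition fits the general formula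
    because p and q both have coefficient 1 at X^d.  Here m = d - k and j are
    kept as indices, so that i = k - j gives d - i = m + j; this is the shape
    that matches coef_iter_bessel_op. *)
Lemma rect_convE (K : numFieldType) (n d : nat) (p q : {poly K}) :
    p`_d = 1 -> q`_d = 1 ->
  rect_conv n d p q =
  \poly_(m < d.+1) \sum_(j < (d - m).+1)
     weight K n (m + j) * weight K n (d - j) / (weight K n d * weight K n m)
       * p`_(m + j) * q`_(d - j).
Proof.
move=> pd qd.
pose c (k : nat) : K := \sum_(j < k.+1)
  weight K n (d - k + j) * weight K n (d - j) /
    (weight K n d * weight K n (d - k)) * p`_(d - k + j) * q`_(d - j).
have c0 : c 0%N = 1.
  by rewrite /c big_ord1 !subn0 addn0 pd qd !mulr1 divff // mulf_neq0
    ?weight_neq0.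
transitivity (\sum_(k < d.+1) c k *: 'X^(d - k)).
  rewrite -(big_mkord xpredT (fun k => c k *: 'X^(d - k))) big_ltn // c0.
  rewrite scale1r subn0 /rect_conv; congr (_ + _).
  rewrite !big_nat; apply: eq_bigr => k /andP [_ kd]; congr (_ *: _).
  rewrite (reindex_inj rev_ord_inj) /=; apply: eq_bigr => j _.
  have jk : (j <= k)%N by rewrite -ltnS.
  have kd' : (k <= d)%N by rewrite -ltnS.
  have jd : (j <= d)%N := leq_trans jk kd'.
  have ijd : (k - j <= d)%N := leq_trans (leq_subr j k) kd'.
  rewrite !subSS subKn // -!addnBA //.
  have -> : (d - (k - j) = d - k + j)%N by rewrite subnBA // addnBAC.
  by rewrite /weight !invfM; ring.
rewrite poly_def (reindex_inj rev_ord_inj) /=; apply: eq_bigr => k _.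
have kd : (k <= d)%N by rewrite -ltnS.
by rewrite subSS /c subKn.
Qed.

Lemma falling_natr (K : numFieldType) (m k : nat) :
  (k <= m)%N -> falling (m%:R : K) k = (m ^_ k)%:R.
Proof.
elim: k => [|k IHk] km; first by rewrite /falling big_ord0.
rewrite /falling big_ord_recr /= -/(falling _ _) IHk ?(ltnW km) //.
by rewrite ffactnSr natrM natrB ?(ltnW km).
Qed.

(** The powers of t come from (- 2 t)^d * (- 1 / (2 t))^(d - k) = (- 2 t)^k. *)
Lemma laguerre_heatE (K : numFieldType) (n d : nat) (t : K) :
  laguerre_heat n d t =
  \sum_(k < d.+1) ((- 2 * t) ^+ k / k`!%:R * weight K n d / weight K n (d - k))
     *: 'X^(d - k).
Proof.
rewrite /laguerre_heat; case: eqP => [->|/eqP t0].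
  rewrite big_ord_recl big1 => [|k _]; last first.
    by rewrite mulr0 exprS !mul0r scale0r.
  by rewrite expr0 subn0 fact0 divr1 mul1r divff ?weight_neq0 // scale1r addr0.
rewrite /laguerre linear_sum scaler_sumr; apply: eq_bigr => k _.
have kd : (k <= d)%N by rewrite -ltnS.
rewrite linearZ /= rmorphXn /= rmorphN /= comp_polyX -scaleNr (exprZn _ 'X).
rewrite !scalerA; congr (_ *: _).
rewrite -natrD falling_natr ?(leq_trans kd) ?leq_addr //.
have -> : ((d + n) ^_ k)%:R = (n + d)`!%:R / (n + (d - k))`!%:R :> K.
  rewrite addnC addnBA // -(@ffact_fact (n + d) k) ?(leq_trans kd) ?leq_addl //.
  by rewrite natrM mulfK ?natf_fact_neq0.
have -> : (- 2 * t) ^+ d = (- 2 * t) ^+ k * (- 2 * t) ^+ (d - k).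
  by rewrite -exprD subnKC.
have -> : - (2 * t)^-1 = (- 2 * t)^-1 by rewrite mulNr invrN.
rewrite exprVn /weight; field.
by rewrite !natf_fact_neq0 expf_neq0 // mulf_neq0 // oppr_eq0 pnatr_eq0.
Qed.

(** By coef_iter_bessel_op, these are the coefficients of exp(- 2 t B) X^d: the
    Laguerre heat polynomial is the heat flow started at X^d. *)
Lemma coef_laguerre_heat (K : numFieldType) (n d j : nat) (t : K) :
    (j <= d)%N ->
  (laguerre_heat n d t)`_(d - j) =
  (- 2 * t) ^+ j / j`!%:R * weight K n d / weight K n (d - j).
Proof.
move=> jd; rewrite laguerre_heatE (reindex_inj rev_ord_inj) /=.
pose c k : K := (- 2 * t) ^+ k / k`!%:R * weight K n d / weight K n (d - k).
rewrite (eq_bigr (fun i : 'I_d.+1 => c (d - i)%N *: 'X^i)); last first.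
  by move=> i _; rewrite subSS /c subKn // -ltnS.
rewrite -(poly_def _ (fun i => c (d - i)%N)) coef_poly ltnS leq_subr.
by rewrite /c subKn.
Qed.

Lemma rect_conv_laguerre_heat (K : numFieldType) (n d : nat) (t : K)
    (p : {poly K}) :
    p`_d = 1 -> (size p <= d.+1)%N ->
  rect_conv n d p (laguerre_heat n d t) = heat_flow n d.+1 (- 2 * t) p.
Proof.
move=> pd sp; rewrite rect_convE //; last first.
  have := @coef_laguerre_heat K n d 0 t isT; rewrite subn0 => ->.
  by rewrite fact0 expr0 divr1 mul1r divff ?weight_neq0.
apply/polyP => m; rewrite coef_poly coef_sum.
under [RHS]eq_bigr => j _ do rewrite coefZ coef_iter_bessel_op.
case: leqP => [dm|md].
  rewrite big1 // => j _.
  by rewrite nth_default ?mulr0 // (leq_trans sp) // (leq_trans dm) ?leq_addr.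
pose F j : K := (- 2 * t) ^+ j / j`!%:R *
  (weight K n (m + j) / weight K n m * p`_(m + j)).
rewrite -!(big_mkord xpredT F) /=.
(* the terms with m + j > d vanish, as p has degree at most d *)
rewrite [RHS](big_cat_nat (n := (d - m).+1)) //= ?ltnS ?leq_subr //.
rewrite [X in _ + X]big_nat [X in _ + X]big1 ?addr0; last first.
  move=> j /andP [jd _]; rewrite /F nth_default ?mulr0 // (leq_trans sp) //.
  by rewrite -ltn_subLR // -ltnS.
rewrite big_mkord; apply: eq_bigr => j _.
have jd : (j <= d)%N by rewrite (leq_trans _ (leq_subr m d)) // -ltnS.
rewrite coef_laguerre_heat // /F; field.
by rewrite natf_fact_neq0 !weight_neq0.
Qed.

(** * Differentiation in time *)

(** The formal counterpart of (exp(c t))' = c exp(c t), for the action on a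
    sequence v that is cut off by a nilpotency condition. *)
Lemma deriv_expsum (K : numFieldType) (N : nat) (c : K) (v : nat -> K) :
    v N = 0 ->
  (\poly_(j < N) (c ^+ j / j`!%:R * v j))^`()%R =
  c *: \poly_(j < N) (c ^+ j / j`!%:R * v j.+1).
Proof.
move=> vN; apply/polyP => m; rewrite coef_deriv coefZ !coef_poly.
have [mN|Nm] := ltnP m N; last by rewrite ltnNge ltnW //= mulr0 mul0rn.
have [m1N|Nm1] := ltnP m.+1 N.
  rewrite -mulr_natr exprS factS natrM; field.
  by rewrite natf_fact_neq0 addrC natr1 pnatr_eq0.
have -> : m.+1 = N by apply/eqP; rewrite eqn_leq mN Nm1.
by rewrite vN !mulr0 mul0rn.
Qed.

(** The induction is carried out over an arbitrary numFieldType, where the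
    ordering of the scalars is only partial, as for complex numbers. *)
Lemma is_derive_horner (K : numFieldType) (q : {poly K}) (t : K^o) :
  is_derive t (1 : K^o) (horner q : K^o -> K^o) q^`().[t].
Proof.
elim/poly_ind: q => [|q c IHq].
  have -> : (horner (0 : {poly K}) : K^o -> K^o) = cst 0.
    by apply/funext => s; rewrite horner0.
  by rewrite deriv0 horner0; exact: is_derive_cst.
have -> : horner (q * 'X + c%:P) = (horner q : K^o -> K^o) * id + cst (c : K^o).
  by apply/funext => s; rewrite hornerMXaddC.
apply: is_derive_eq.
rewrite derivMXaddC hornerD hornerM hornerX /GRing.scale /=; ring.
Qed.

Lemma is_derive_within_horner (K : numFieldType) (D : set K) (q : {poly K})
    (t : K) :
  is_derive_within D (horner q) t q^`().[t].
Proof.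
have [_ H] := @is_derive_within_nbhs K setT (horner q) t q^`().[t] filterT.
apply: cvg_trans (H (is_derive_horner K q t)).
by apply: cvg_fmap2; exact: within_subset.
Qed.

Lemma heat_flow_is_derive (K : numFieldType) (D : set K) (n N : nat) (c t x : K)
    (p : {poly K}) :
    (size p <= N)%N ->
  is_derive_within D (fun s => (heat_flow n N (c * s) p).[x]) t
    (c * (bessel_op n (heat_flow n N (c * t) p)).[x]).
Proof.
move=> pN; pose v j := (iter j (bessel_op n) p).[x].
have vN : v N = 0 by rewrite /v iter_bessel_op_eq0 // horner0.
have -> : (fun s => (heat_flow n N (c * s) p).[x]) =
    horner (\poly_(j < N) (c ^+ j / j`!%:R * v j)).
  apply/funext => s; rewrite horner_poly horner_sum; apply: eq_bigr => j _.
  by rewrite hornerZ exprMn /v; ring.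
suff -> : c * (bessel_op n (heat_flow n N (c * t) p)).[x] =
    (\poly_(j < N) (c ^+ j / j`!%:R * v j))^`().[t].
  exact: is_derive_within_horner.
rewrite deriv_expsum // hornerZ horner_poly; congr (_ * _).
rewrite /heat_flow (bessel_op_lincomb _ _ _ (fun j => (c * t) ^+ j / j`!%:R)
  (fun j => iter j (bessel_op n) p)) horner_sum.
by apply: eq_bigr => j _; rewrite hornerZ exprMn /v iterS; ring.
Qed.

Lemma heat_flow0 (K : numFieldType) (n N : nat) (p : {poly K}) :
  heat_flow n N.+1 0 p = p.
Proof.
rewrite /heat_flow big_ord_recl expr0 fact0 divr1 scale1r big1 ?addr0 //.
by move=> j _; rewrite exprS !mul0r scale0r.
Qed.

Theorem theorem2p4 (K : numFieldType) (n d : nat) (hd : (1 <= d)%N)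
    (hdn : (d <= n)%N) (p : {poly K}) (p_monic : p \is monic)
    (p_deg : size p = d.+1) :
  let P (t : K) : {poly K} := rect_conv n d p (laguerre_heat n d t) in
  (forall t x : K, 0 <= t ->
     is_derive_within [set s : K | 0 <= s] (fun s => (P s).[x]) t
       (- 2 * (x * (P t)^`(2).[x] + (n%:R + 1) * (P t)^`().[x])))
  /\ P 0 = p.
Proof.
move=> P.
have PE t : P t = heat_flow n d.+1 (- 2 * t) p.
  apply: rect_conv_laguerre_heat; last by rewrite p_deg.
  by move: p_monic; rewrite monicE lead_coefE p_deg => /eqP.
split=> [t x _|]; last by rewrite PE mulr0 heat_flow0.
rewrite (_ : (fun s => _) = fun s => (heat_flow n d.+1 (- 2 * s) p).[x]); last first.
  by apply/funext => s; rewrite PE.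
have -> : x * (P t)^`(2).[x] + (n%:R + 1) * (P t)^`().[x] =
    (bessel_op n (P t)).[x].
  by rewrite /bessel_op hornerD hornerM hornerX hornerZ.
by rewrite PE; apply: heat_flow_is_derive; rewrite p_deg.
Qed.
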